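(* Let $\mathbf A \in \mathcal{I}_{2,0} \cap \mathcal{MC}$. Then $\mathbf{A^{mj}}$ satisfies: (a) $x \land x \approx x$; (b) $x \lor x \approx x$; (c) $x \lor y \approx y \lor x$; (d) $x \land (y \lor z) \approx (x \land y) \lor (x \land z)$; (e) $x \lor (y \land z) \approx (x \lor y) \land (x \lor z)$; (f) $x \land (x \lor y) \approx x \lor (x \land y)$.
   Context: An implicator groupoid is an algebra $\mathbf A = \langle A, \to, 0 \rangle$, with $\to$ binary and $0$ a constant, which, writing $x' := x \to 0$, satisfies the identities (I) $(x \to y) \to z \approx [(z' \to x) \to (y \to z)']'$ and (I$_0$) $0'' \approx 0$. Put $x \land y := (x \to y')'$ and $x \lor y := (x' \land y')'$, and let $\mathbf{A^{mj}} := \langle A, \land, \lor, 0 \rangle$. $\mathcal{I}_{2,0}$ and $\mathcal{MC}$ are the varieties of implicator groupoids satisfying, respectively, $x'' \approx x$ and $x \land y \approx y \land x$. *)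

(* Defs.v *)
Record groupoid0 : Type := Groupoid0 {
  carrier :> Type;
  imp : carrier -> carrier -> carrier;
  zero : carrier
}.

Arguments imp {g} _ _.
Arguments zero {g}.

Declare Scope igroupoid_scope.
Delimit Scope igroupoid_scope with ig.

Notation "x ~> y" := (imp x y)
  (at level 55, right associativity) : igroupoid_scope.

Local Open Scope igroupoid_scope.

Definition neg {A : groupoid0} (x : A) : A := x ~> zero.

Notation "x ^'" := (neg x) (at level 2, format "x ^'") : igroupoid_scope.

Record is_implicator_groupoid (A : groupoid0) : Prop := {
  axiom_I : forall x y z : A,
    (x ~> y) ~> z = ((z^' ~> x) ~> (y ~> z)^')^';
  axiom_I0 : (@zero A)^'^' = zero
}.

Definition meet {A : groupoid0} (x y : A) : A := (x ~> y^')^'.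
Definition join {A : groupoid0} (x y : A) : A := (meet x^' y^')^'.

Definition in_I20 (A : groupoid0) : Prop :=
  is_implicator_groupoid A /\ forall x : A, x^'^' = x.

Definition in_MC (A : groupoid0) : Prop :=
  is_implicator_groupoid A /\ forall x y : A, meet x y = meet y x.

Record mj_algebra : Type := MjAlgebra {
  mj_carrier :> Type;
  mj_meet : mj_carrier -> mj_carrier -> mj_carrier;
  mj_join : mj_carrier -> mj_carrier -> mj_carrier;
  mj_zero : mj_carrier
}.

Arguments mj_meet {m} _ _.
Arguments mj_join {m} _ _.
Arguments mj_zero {m}.

Notation "x ⊓ y" := (mj_meet x y)
  (at level 40, left associativity) : igroupoid_scope.
Notation "x ⊔ y" := (mj_join x y)
  (at level 50, left associativity) : igroupoid_scope.

Definition mj (A : groupoid0) : mj_algebra :=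
  MjAlgebra A (@meet A) (@join A) (@zero A).

(* Main.v *)
Require Import Defs.

Local Open Scope igroupoid_scope.

(** Since the negation is an involution, [x ~> y] is nothing but [x^' ⊔ y], and
    [⊓] and [⊔] are exchanged by De Morgan duality.  In these terms identity (I)
    reads [(x ⊓ y) ⊔ z = (z ⊔ x) ⊓ (y ⊔ z)], which, once [⊔] is commutative (the
    dual of the hypothesis on [⊓]), is distributivity of [⊔] over [⊓]; the other
    distributive law is its dual.  The definition of the negation, [x ~> 0 = x^'],
    says that [0] is neutral for [⊔], hence [1 := 0^'] is neutral for [⊓].

    Idempotence then comes from the constants.  Distributivity gives
    [x ⊔ (0 ⊓ 0) = (x ⊔ 0) ⊓ (x ⊔ 0) = x ⊓ x], so it suffices that [0 ⊓ 0 = 0],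
    that is [1 ⊔ 1 = 1].  Expanding [0 = 0 ⊓ 1] in [1 ⊔ (0 ⊓ 1) = 1] yields
    [1 = 1 ⊓ (1 ⊔ 1) = 1 ⊔ 1].  Finally [x ⊓ (x ⊔ y)] distributes to
    [(x ⊓ x) ⊔ (x ⊓ y) = x ⊔ (x ⊓ y)]. *)

Section MeetJoinReduct.

Variable A : groupoid0.
Hypothesis negK : forall x : A, x^'^' = x.

Lemma join_imp (x y : A) : join x y = x^' ~> y.
Proof. unfold join, meet. now rewrite !negK. Qed.

Lemma imp_join (x y : A) : x ~> y = join x^' y.
Proof. now rewrite join_imp, negK. Qed.

Lemma neg_meet (x y : A) : (meet x y)^' = join x^' y^'.
Proof. unfold join. now rewrite !negK. Qed.

Lemma neg_join (x y : A) : (join x y)^' = meet x^' y^'.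
Proof. unfold join. now rewrite negK. Qed.

Lemma join0 (x : A) : join x zero = x.
Proof. rewrite join_imp. apply negK. Qed.

Lemma meet1 (x : A) : meet x zero^' = x.
Proof. unfold meet. rewrite negK. apply negK. Qed.

Hypothesis meetC : forall x y : A, meet x y = meet y x.

Lemma joinC (x y : A) : join x y = join y x.
Proof. unfold join. now rewrite meetC. Qed.

Hypothesis axI : forall x y z : A,
  (x ~> y) ~> z = ((z^' ~> x) ~> (y ~> z)^')^'.

(** This is identity (I) at [y], [z^'] and [x], once implications are read as
    joins and the outer negations are pushed inwards. *)
Lemma join_meetr (x y z : A) :
  join x (meet y z) = meet (join x y) (join x z).
Proof.
  pose proof (axI y z^' x) as H.
  rewrite !imp_join, !neg_join, !neg_meet, !negK in H.
  now rewrite joinC, H, (joinC z x).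
Qed.

Lemma meet_joinr (x y z : A) :
  meet x (join y z) = join (meet x y) (meet x z).
Proof.
  rewrite <- (negK (meet x (join y z))), neg_meet, (neg_join y z), join_meetr.
  now rewrite neg_meet, !neg_join, !negK.
Qed.

Lemma join11 : join (@zero A)^' zero^' = zero^'.
Proof.
  pose proof (join_meetr zero^' zero zero^') as H.
  now rewrite meet1, join0, (meetC zero^' (join _ _)), meet1 in H.
Qed.

Lemma meet_idem (x : A) : meet x x = x.
Proof.
  assert (H00 : meet (@zero A) zero = zero).
  { now rewrite <- (negK (meet zero zero)), neg_meet, join11, negK. }
  pose proof (join_meetr x zero zero) as H.
  now rewrite H00, join0 in H.
Qed.

Lemma join_idem (x : A) : join x x = x.
Proof. unfold join. now rewrite meet_idem, negK. Qed.

Lemma meet_join_exchange (x y : A) : meet x (join x y) = join x (meet x y).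
Proof. now rewrite meet_joinr, meet_idem. Qed.

End MeetJoinReduct.

Theorem theorem7p3 (A : groupoid0) (hI20 : in_I20 A) (hMC : in_MC A) :
  (forall x : mj A, x ⊓ x = x) /\
  (forall x : mj A, x ⊔ x = x) /\
  (forall x y : mj A, x ⊔ y = y ⊔ x) /\
  (forall x y z : mj A, x ⊓ (y ⊔ z) = (x ⊓ y) ⊔ (x ⊓ z)) /\
  (forall x y z : mj A, x ⊔ (y ⊓ z) = (x ⊔ y) ⊓ (x ⊔ z)) /\
  (forall x y : mj A, x ⊓ (x ⊔ y) = x ⊔ (x ⊓ y)).
Proof.
  destruct hI20 as [[axI _] negK], hMC as [_ meetC].
  repeat split; cbn.
  - now apply meet_idem.
  - now apply join_idem.
  - now apply joinC.
  - now apply meet_joinr.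
  - now apply join_meetr.
  - now apply meet_join_exchange.
Qed.
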